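(* Let $k,\ell\in\mathbb{N}$ with $k\ge 2$. Let $H$ be a graph on $|H|$ vertices with $\ell$ edges and let $\Delta=\Delta(H)$ be its maximum degree. Then $$\tilde r(P_{k+1},H)\ \ge\ \begin{cases}(2\Delta+1)\ell/(2\Delta) & \text{if } k=2,\\ (5\Delta+4)\ell/(5\Delta) & \text{if } k=3,\\ (\Delta+1)\ell/\Delta & \text{if } k\ge 4.\end{cases}$$ Moreover, if $H$ is connected and $k\ge 4$, then $$\tilde r(P_{k+1},H)\ \ge\ \frac{(\Delta+1)\ell}{\Delta}+\min\left\{\frac{k}{2}-2,\ |H|-1\right\}.$$
   Context: $\mathbb{N}=\{1,2,\dots\}$; graphs $G,H$ are finite and simple. $P_s$ denotes the path on $s$ vertices. Let $K_{\mathbb{N}}$ be the infinite complete graph on vertex set $\mathbb{N}$. In the $\tilde r(G,H)$-game, two players, Builder and Painter, play on the edge set of $K_{\mathbb{N}}$, with no edges coloured initially. In each round Builder chooses an edge and Painter colours it red or blue. Builder wins as soon as there is a red copy of $G$ or a blue copy of $H$. The on-line Ramsey number $\tilde r(G,H)$ is the minimum number of rounds within which Builder can guarantee to win, assuming both players play optimally (Builder minimising and Painter maximising the number of rounds). *)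

(* Defs.v *)
From HB Require Import structures.
From mathcomp Require Import all_boot all_order.
From mathcomp Require Import boolp.

Set Implicit Arguments.
Unset Strict Implicit.
Unset Printing Implicit Defensive.

Record sgraph := SGraph {
  vertex :> finType;
  adj : rel vertex;
  adj_sym : symmetric adj;
  adj_irrefl : irreflexive adj
}.

Definition edge_set (G : sgraph) : {set {set G}} :=
  [set E | [exists x : G, exists y : G, adj x y && (E == [set x; y])]].

Definition n_edges (G : sgraph) : nat := #|edge_set G|.

Definition degree (G : sgraph) (x : G) : nat := #|[set y : G | adj x y]|.

Definition max_degree (G : sgraph) : nat := \max_(x : G) degree x.

Definition connected (G : sgraph) : Prop :=
  forall x y : G, connect (@adj G) x y.

Definition path_adj (s : nat) : rel 'I_s :=
  [rel i j : 'I_s | (i.+1 == j :> nat) || (j.+1 == i :> nat)].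

Lemma path_adj_sym (s : nat) : symmetric (@path_adj s).
Proof. by move=> i j; rewrite /path_adj /= orbC. Qed.

Lemma path_adj_irrefl (s : nat) : irreflexive (@path_adj s).
Proof. by move=> i; rewrite /path_adj /= orbb eqn_leq ltnn. Qed.

Definition path_graph (s : nat) : sgraph :=
  SGraph (@path_adj_sym s) (@path_adj_irrefl s).

(* The vertices of K_N are labelled by nat, starting at 0; an edge of K_N is   *)
(* stored once, with its smaller endpoint first.                              *)
Definition edge := {e : nat * nat | e.1 < e.2}.

Definition colour := bool.
Definition red : colour := true.
Definition blue : colour := false.

(* The edges coloured so far, the most recent one first. *)
Definition position := seq (edge * colour).

Definition coloured (p : position) : seq edge := [seq m.1 | m <- p].

Definition joined (p : position) (c : colour) (x y : nat) : bool :=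
  has (fun m : edge * colour =>
         (m.2 == c) && ((val m.1 == (x, y)) || (val m.1 == (y, x)))) p.

Definition has_copy (G : sgraph) (c : colour) (p : position) : Prop :=
  exists2 f : G -> nat,
    injective f & forall x y : G, adj x y -> joined p c (f x) (f y).

Definition won (G H : sgraph) (p : position) : Prop :=
  has_copy G red p \/ has_copy H blue p.

Definition builder_strategy := position -> edge.
Definition painter_strategy := position -> edge -> colour.

(* Asking for a new edge at every position, reachable or not, is harmless,     *)
(* because every position leaves uncoloured edges.                            *)
Definition legal (sigma : builder_strategy) : Prop :=
  forall p : position, sigma p \notin coloured p.

Fixpoint play (sigma : builder_strategy) (tau : painter_strategy) (n : nat) :
    position :=
  if n is m.+1 then
    let p := play sigma tau m in (sigma p, tau p (sigma p)) :: p
  else [::].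

Definition builder_wins_within (G H : sgraph) (n : nat) : Prop :=
  exists2 sigma : builder_strategy, legal sigma &
    forall tau : painter_strategy,
      exists2 m : nat, m <= n & won G H (play sigma tau m).

(* Ramsey's theorem: some number of rounds always suffices, so that the        *)
(* minimum defining the on-line Ramsey number exists.                         *)

Lemma ramsey (c : rel nat) (s t : nat) (S : seq nat) :
  symmetric c -> uniq S -> 2 ^ (s + t) <= size S ->
  (exists A : seq nat, [/\ uniq A, size A = s, {subset A <= S} &
     {in A &, forall x y, x != y -> c x y}]) \/
  (exists A : seq nat, [/\ uniq A, size A = t, {subset A <= S} &
     {in A &, forall x y, x != y -> ~~ c x y}]).
Proof.
move=> csym; have [n] := ubnP (s + t).
elim: n s t S => // n IHn [|s] [|t] S; try by left; exists [::].
  by right; exists [::].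
rewrite ltnS => le_n; case: S => [|x S] /=.
  by rewrite leqn0 expn_eq0.
case/andP=> xS uS; rewrite addSn expnS mul2n -addnn => leS.
have sz : size (filter (c x) S) + size (filter (predC (c x)) S) = size S.
  by rewrite !size_filter count_predC.
have [le1|lt1] := leqP (2 ^ (s + t.+1)) (size (filter (c x) S)).
  have [||[A [uA sA subA hA]]|[A [uA sA subA hA]]] := IHn s t.+1 _ _ _ le1.
  - by [].
  - exact: filter_uniq.
  - have hx y : y \in A -> c x y /\ y \in S.
      by move/subA; rewrite mem_filter => /andP[].
    left; exists (x :: A); split=> //=; first 1 last.
    + by rewrite sA.
    + by move=> y; rewrite !inE => /orP[->//|/hx[_ ->]]; rewrite orbT.
    + move=> y z; rewrite !inE => /orP[/eqP->|yA] /orP[/eqP->|zA].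
      * by rewrite eqxx.
      * by move=> _; have [] := hx z zA.
      * by move=> _; rewrite csym; have [] := hx y yA.
      * exact: hA.
    + by rewrite uA andbT; apply: contra xS => /hx[].
  - right; exists A; split=> // y /subA.
    by rewrite mem_filter => /andP[_ yS]; rewrite inE yS orbT.
have le2 : 2 ^ (s.+1 + t) <= size (filter (predC (c x)) S).
  rewrite addSnnS.
  have : 2 ^ (s + t.+1) + 2 ^ (s + t.+1) <=
      (size (filter (c x) S) + size (filter (predC (c x)) S)).+1 by rewrite sz.
  move=> h; rewrite -(leq_add2l (2 ^ (s + t.+1))); apply: leq_trans h _.
  by rewrite -addSn leq_add2r.
have [||[A [uA sA subA hA]]|[A [uA sA subA hA]]] := IHn s.+1 t _ _ _ le2.
- by rewrite addSnnS.
- exact: filter_uniq.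
- left; exists A; split=> // y /subA.
  by rewrite mem_filter => /andP[_ yS]; rewrite inE yS orbT.
have hx y : y \in A -> ~~ c x y /\ y \in S.
  by move/subA; rewrite mem_filter => /andP[].
right; exists (x :: A); split=> //=; first 1 last.
- by rewrite sA.
- by move=> y; rewrite !inE => /orP[->//|/hx[_ ->]]; rewrite orbT.
- move=> y z; rewrite !inE => /orP[/eqP->|yA] /orP[/eqP->|zA].
  + by rewrite eqxx.
  + by move=> _; have [] := hx z zA.
  + by move=> _; rewrite csym; have [] := hx y yA.
  + exact: hA.
- by rewrite uA andbT; apply: contra xS => /hx[].
Qed.

Lemma joined_sym (p : position) (c : colour) : symmetric (joined p c).
Proof. by move=> x y; apply: eq_has => m; rewrite orbC. Qed.

Lemma clique_copy (G : sgraph) (c : colour) (p : position) (A : seq nat) :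
  uniq A -> size A = #|G| ->
  {in A &, forall x y, x != y -> joined p c x y} -> has_copy G c p.
Proof.
move=> uA sA hA; exists (fun x : G => nth 0 A (enum_rank x)).
  move=> x y /eqP; rewrite nth_uniq ?sA ?ltn_ord //.
  by move/eqP/val_inj/enum_rank_inj.
move=> x y xy; apply: hA; rewrite ?mem_nth ?sA ?ltn_ord //.
rewrite nth_uniq ?sA ?ltn_ord //; apply/eqP => /val_inj/enum_rank_inj exy.
by move: xy; rewrite exy adj_irrefl.
Qed.

Lemma fresh_edge (s : seq edge) :
  exists e : edge, e \notin s /\
    forall e' : edge, e' \notin s -> pickle e <= pickle e'.
Proof.
have [e0 e0s] : exists e : edge, e \notin s.
  pose m := \max_(e <- s) (val e).2.
  pose e0 : edge := exist (fun e : nat * nat => e.1 < e.2) (0, m.+1) isT.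
  exists e0; apply/negP => h.
  by have := @leq_bigmax_seq _ s xpredT (fun e => (val e).2) e0 h isT; rewrite ltnn.
pose P n := `[< exists2 e : edge, e \notin s & pickle e = n >].
have exP : exists n, P n by exists (pickle e0); apply/asboolP; exists e0.
case: (ex_minnP exP) => n /asboolP[e es <-] minn; exists e; split=> // e' e's.
by apply: minn; apply/asboolP; exists e'.
Qed.

Lemma builder_wins (G H : sgraph) : exists n, builder_wins_within G H n.
Proof.
have [sigma0 hs] := choice fresh_edge.
pose sigma (p : position) := sigma0 (coloured p).
have all_col tau n e : pickle e < n -> e \in coloured (play sigma tau n).
  apply: contraTT => he; rewrite -leqNgt.
  pose s := coloured (play sigma tau n).
  have [us ltS] : uniq s /\ all (fun e' => pickle e' < pickle e) s.
    rewrite /s; elim: n he {s} => //= n IHn; rewrite inE negb_or => /andP[ne he].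
    have [us lts] := IHn he; rewrite us lts !andbT; split.
      by have [] := hs (coloured (play sigma tau n)).
    rewrite ltn_neqAle (inj_eq (pcan_inj pickleK)) eq_sym ne.
    by have [_] := hs (coloured (play sigma tau n)); exact.
  have <- : size s = n by rewrite size_map; elim: (n) => //= m ->.
  have : size (map pickle s) <= size (iota 0 (pickle e)).
    apply: uniq_leq_size.
      by rewrite map_inj_uniq //; exact: (pcan_inj pickleK).
    move=> _ /mapP[e' e's ->]; rewrite mem_iota add0n.
    exact: (allP ltS).
  by rewrite size_map size_iota.
pose R := 2 ^ (#|G| + #|H|).
pose code i j := oapp pickle 0 (insub (i, j) : option edge).
pose N := (\max_(i < R) \max_(j < R) code i j).+1.
exists N, sigma => [p|tau]; first by have [] := hs (coloured p).
exists N => //; have {}all_col := all_col tau N.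
move: (play sigma tau N) all_col => p all_col.
have col x y : x < y -> y < R -> joined p red x y || joined p blue x y.
  move=> xy yR.
  have /mapP[[e c] mp /= ee] : (Sub (x, y) xy : edge) \in coloured p.
    apply: all_col; rewrite ltnS.
    have -> : pickle (Sub (x, y) xy : edge) = code x y.
      by rewrite /code insubT.
    apply: leq_trans (leq_bigmax (Ordinal (ltn_trans xy yR))).
    exact: (leq_bigmax (Ordinal yR)).
  apply/orP; case: c mp => mp; [left|right]; rewrite /joined; apply/hasP.
    by exists (e, true); rewrite //= -ee eqxx.
  by exists (e, false); rewrite //= -ee eqxx.
have col' x y : x != y -> x < R -> y < R -> joined p red x y || joined p blue x y.
  case: (ltngtP x y) => // [xy|yx] _ xR yR; first exact: col.
  by rewrite joined_sym (joined_sym _ blue) col.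
have [] := @ramsey (joined p red) #|G| #|H| (iota 0 R) (@joined_sym p red).
- exact: iota_uniq.
- by rewrite size_iota.
- by move=> [A [uA sA _ hA]]; left; exact: clique_copy hA.
move=> [A [uA sA subA hA]]; right; apply: (clique_copy uA sA) => x y xA yA xy.
have ltR z : z \in A -> z < R by move/subA; rewrite mem_iota.
have := col' x y xy (ltR x xA) (ltR y yA).
by rewrite (negbTE (hA _ _ xA yA xy)).
Qed.

Lemma builder_winsb (G H : sgraph) : exists n, `[< builder_wins_within G H n >].
Proof. by have [n hn] := builder_wins G H; exists n; apply/asboolP. Qed.

Definition online_ramsey (G H : sgraph) : nat := ex_minn (builder_winsb G H).

Lemma online_ramseyP (G H : sgraph) (r : nat) :
  online_ramsey G H = r <->
  builder_wins_within G H r /\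
  forall n : nat, builder_wins_within G H n -> r <= n.
Proof.
rewrite /online_ramsey; case: ex_minnP => m /asboolP wm minm.
split=> [<-|[wr minr]]; first by split=> // n wn; apply: minm; apply/asboolP.
by apply/eqP; rewrite eqn_leq minr // andbT; apply: minm; apply/asboolP.
Qed.

(* Main.v *)
Require Import Defs.
From mathcomp Require Import all_boot all_order all_algebra.
From mathcomp Require Import boolp zify ring lra.

Set Implicit Arguments.
Unset Strict Implicit.
Unset Printing Implicit Defensive.

(** Painter keeps an invariant with two consequences: red contains no path on
    k+1 vertices, and the vertices carry weights 0, 1, 2 such that the two ends of
    each blue edge have total weight at least 2.  Weights never decrease during
    the game, so a blue edge stays covered once it is covered.  If a blue copy of
    [H] with l edges and maximum degree Delta appears, summing over its edges gives
    2 l <= Delta W, where W is the total weight ([arcs_weight]).  If moreover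
    a W + b <= c R for the number R of red edges, then R is at least
    (2 a l / Delta + b) / c, while there are at least l blue edges; this is
    [online_bound].  It remains to play so that W is small compared with R.

    k = 2.  Red is a matching whose vertices weigh 2, so W = 4 R.

    k = 3.  Red is a union of single edges, whose ends weigh 1, and of stars
    with at least two edges, whose centre weighs 1 and whose leaves weigh 2.  A star
    with s edges weighs 2 s + 1 <= 5 s / 2, a single edge weighs 2 <= 5 / 2, so
    2 W <= 5 R.

    k >= 4.  Vertices are grouped into cores of at most k - 2 vertices, and further
    vertices, the leaves, hang by one red edge on cores with exactly k - 2
    vertices.  The interior of a red path avoids leaves, so it lies in one core and
    the path has at most k vertices.  Vertices of a core with at least two vertices
    weigh 1, leaves weigh 2.  As every core is connected in red,
    R >= #leaves + sum (size - 1), whence 2 R - W >= sum (size - 2) >= 0, the last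
    sum being over the cores with at least two vertices.

    The additive term comes from 2 R - W >= k - 4, which has to hold as soon as some
    edge is blue.  It does when some core is full, that is, has k - 2 vertices.
    Edges inside a core are red, and so are edges between cores that fit together or
    from an untouched vertex to a full core, so the remaining case is a blue edge
    between two cores of sizes a, b >= 2 with a + b > k - 2.  If a + b >= k then
    (a - 2) + (b - 2) >= k - 4.  If a + b = k - 1 this is short by one.  Then either
    one of the cores contains a red cycle, and the superfluous red edge contributes
    2 to 2 R - W; or both are trees, and Painter colours the edge red and declares
    an end vertex of the resulting tree on k - 1 vertices to be a leaf, which makes
    the core full. *)

(** * Positions *)

Definition ncol (c : colour) (p : position) : nat := count (fun m => m.2 == c) p.

(** All sums over vertices are taken below a bound [N] on the vertices played;
    invariants are stated for every such [N], since the bound grows during the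
    game. *)
Definition below (N : nat) (p : position) : Prop :=
  forall c x y, joined p c x y -> x < N.

(** An edge is stored with its smaller end first; [ends] forgets this order, so
    that the roles of the two ends can be exchanged. *)
Definition ends (e : edge) (u v : nat) : bool :=
  (val e == (u, v)) || (val e == (v, u)).

Lemma ends_sym e u v : ends e u v = ends e v u.
Proof. exact: orbC. Qed.

Lemma ends_neq e u v : ends e u v -> u != v.
Proof. by case: e => -[a b] /= ab /orP[] /eqP[<- <-]; lia. Qed.

Lemma joined_cons e u v c0 c p x y : ends e u v ->
  joined ((e, c0) :: p) c x y =
  (c0 == c) && ((x == u) && (y == v) || (x == v) && (y == u)) || joined p c x y.
Proof.
rewrite /joined /ends /= => /orP[] /eqP ->; congr (_ && _ || _);
  by rewrite !xpair_eqE !(eq_sym x) !(eq_sym y); do 4 case: eqP => ?.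
Qed.

Lemma below_cons N e u v c p : ends e u v -> below N ((e, c) :: p) ->
  [/\ u < N, v < N & below N p].
Proof.
move=> euv b; split.
- by apply: (b c u v); rewrite (joined_cons _ _ _ _ _ euv) !eqxx.
- by apply: (b c v u); rewrite (joined_cons _ _ _ _ _ euv) !eqxx orbT.
- by move=> c' x y j; apply: (b c' x y); rewrite (joined_cons _ _ _ _ _ euv) j orbT.
Qed.

Lemma joined_neq p c x y : joined p c x y -> x != y.
Proof.
move=> /hasP[[e c'] _ /= /andP[_ exy]].
by apply: (@ends_neq e).
Qed.

Lemma edge_ends e : exists u v, ends e u v.
Proof. by exists (val e).1, (val e).2; rewrite /ends -surjective_pairing eqxx. Qed.

Lemma ncol_red e p : ncol red ((e, red) :: p) = (ncol red p).+1.
Proof. by []. Qed.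

Lemma size_ncol p : ncol red p + ncol blue p = size p.
Proof.
rewrite /ncol -(count_predC (fun m : edge * colour => m.2 == red) p); congr (_ + _).
by apply: eq_count => -[e []].
Qed.

(** Painter needs no explicit strategy: an invariant that one of the two answers
    always preserves yields one, namely to answer red exactly when red preserves
    it. *)
Lemma invariant_survives (G H : sgraph) (Good : position -> Prop) :
  Good [::] -> (forall p e, Good p -> exists c, Good ((e, c) :: p)) ->
  exists p, [/\ Good p, size p <= online_ramsey G H & won G H p].
Proof.
move=> G0 GS.
have [[sigma _ wins] _] := (online_ramseyP G H _).1 erefl.
pose tau p e : colour := `[< Good ((e, red) :: p) >].
have [m lem wm] := wins tau; exists (play sigma tau m); split=> //.
- elim: m {lem wm} => //= m IHm.
  case E: (tau _ _); first by move/asboolP: E.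
  case: (GS _ (sigma (play sigma tau m)) IHm) => -[] //.
  by move/asboolP; rewrite -[asbool _]/(tau _ _) E.
- suff -> : size (play sigma tau m) = m by [].
  by elim: m {lem wm} => //= m ->.
Qed.

(** * Counting blue edges *)

Definition arcs (H : sgraph) : {set H * H} := [set a | adj a.1 a.2].

Lemma edges_arcs (H : sgraph) : 2 * n_edges H <= #|arcs H|.
Proof.
pose ed (a : H * H) := [set a.1; a.2].
rewrite -[X in _ <= X]sum1_card (partition_big ed (mem (edge_set H))) /=; last first.
  move=> [x y]; rewrite !inE => a.
  by apply/existsP; exists x; apply/existsP; exists y; rewrite a eqxx.
rewrite mulnC /n_edges -sum_nat_const; apply: leq_sum => E; rewrite inE.
case/existsP=> x /existsP[y /andP[xy /eqP ->]].
have ne : x != y by apply: contraTneq xy => ->; rewrite adj_irrefl.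
rewrite sum1_card.
have <- : #|[set (x, y); (y, x)]| = 2.
  by rewrite cards2 xpair_eqE negb_and ne.
apply/subset_leq_card/subsetP => a; rewrite !inE => /orP[] /eqP -> /=.
  by rewrite unfold_in /= inE xy eqxx.
by rewrite unfold_in /= inE adj_sym xy /ed /= setUC eqxx.
Qed.

(** Arcs map injectively to the two orientations of the blue entries. *)
Lemma arcs_blue (H : sgraph) p (f : H -> nat) : injective f ->
  (forall x y, adj x y -> joined p blue (f x) (f y)) ->
  #|arcs H| <= 2 * ncol blue p.
Proof.
move=> finj fj.
pose q := [seq val m.1 | m <- p & m.2 == blue].
have -> : 2 * ncol blue p = size (q ++ [seq (a.2, a.1) | a <- q]).
  by rewrite size_cat size_map /q size_map size_filter mul2n addnn.
rewrite cardE -(size_map (fun a : H * H => (f a.1, f a.2))); apply: uniq_leq_size.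
  by rewrite map_inj_uniq ?enum_uniq // => -[x y] [x' y'] [/finj -> /finj ->].
move=> z /mapP[[x y] /=]; rewrite mem_enum inE /= => /fj /hasP[m mp].
case/andP=> mb xy -> {z}; rewrite mem_cat.
have mq : val m.1 \in q by apply/mapP; exists m => //; rewrite mem_filter mb.
case/orP: xy => /eqP E; first by rewrite -E mq.
by apply/orP; right; apply/mapP; exists (val m.1); rewrite // E.
Qed.

(** Double counting: a vertex of [H] pays its weight once for each of its at most
    [max_degree H] edges, and each edge, met from both ends, receives at least 2. *)
Lemma arcs_weight (H : sgraph) (w : nat -> nat) (f : H -> nat) N :
  injective f -> (forall x, f x < N) ->
  (forall x y, adj x y -> 2 <= w (f x) + w (f y)) ->
  #|arcs H| <= max_degree H * \sum_(v < N) w v.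
Proof.
move=> finj fN cover.
have deg : \sum_(a in arcs H) w (f a.1) = \sum_x degree x * w (f x).
  rewrite (eq_bigl (fun a : H * H => xpredT a.1 && adj a.1 a.2)); last first.
    by move=> a; rewrite inE.
  rewrite -(pair_big_dep xpredT (fun x y : H => adj x y) (fun x _ => w (f x))) /=.
  by apply: eq_bigr => x _; rewrite sum_nat_const /degree cardsE.
have flip : \sum_(a in arcs H) w (f a.2) = \sum_(a in arcs H) w (f a.1).
  rewrite (reindex_inj (h := fun a : H * H => (a.2, a.1))) /=; last first.
    by move=> [x y] [x' y'] [-> ->].
  by apply: eq_bigl => a; rewrite !inE /= adj_sym.
have le1 : #|arcs H| * 2 <= \sum_(a in arcs H) (w (f a.1) + w (f a.2)).
  by rewrite -sum_nat_const; apply: leq_sum => a; rewrite inE => /cover.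
have le2 : \sum_x degree x * w (f x) <= max_degree H * \sum_x w (f x).
  rewrite big_distrr /=; apply: leq_sum => x _; rewrite leq_mul2r.
  by rewrite (leq_bigmax x) orbT.
have le3 : \sum_x w (f x) <= \sum_(v < N) w v.
  pose g x := Ordinal (fN x).
  have ginj : injective g by move=> x y /(congr1 val) /finj.
  rewrite [X in _ <= X](bigID (mem (g @: [set: H]))) /=.
  rewrite big_imset /=; last by move=> x y _ _ /ginj.
  rewrite [X in _ <= X + _](eq_bigl xpredT) ?leq_addr // => x.
  by rewrite inE.
move: le1; rewrite big_split /= flip addnn -muln2 leq_pmul2r // deg => le1.
by apply: leq_trans le1 (leq_trans le2 _); rewrite leq_mul2l le3 orbT.
Qed.

Lemma below_large p : exists N, forall M, N <= M -> below M p.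
Proof.
elim: p => [|[e c] p [N bN]]; first by exists 0.
exists (N + (val e).1.+1 + (val e).2.+1) => M leM c' x y.
have ee : ends e (val e).1 (val e).2 by rewrite /ends -surjective_pairing eqxx.
rewrite (joined_cons _ _ _ _ _ ee) => /orP[/andP[_ xy]|]; last by apply: bN; lia.
by case/orP: xy => /andP[/eqP -> _]; lia.
Qed.

(** The common frame of the three ranges of k.  Weights are only requested when a
    blue edge exists, which lets [b] be positive. *)
Lemma online_bound (G H : sgraph) (a b c : nat) (Good : position -> Prop) :
  0 < n_edges H ->
  Good [::] -> (forall p e, Good p -> exists c0, Good ((e, c0) :: p)) ->
  (forall p, Good p -> ~ has_copy G red p) ->
  (forall p x y, Good p -> joined p blue x y ->
     exists2 w : nat -> nat, forall x y, joined p blue x y -> 2 <= w x + w y &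
       forall N, below N p -> a * (\sum_(v < N) w v) + b <= c * ncol red p) ->
  exists2 R, n_edges H + R <= online_ramsey G H &
    2 * a * n_edges H + max_degree H * b <= max_degree H * c * R.
Proof.
move=> l0 G0 GS noG wt.
have [p [gp szp [/(noG p gp)//|[f finj fj]]]] := invariant_survives G H G0 GS.
have le_arcs := edges_arcs H.
have [[x y] xy] : exists u : H * H, u \in arcs H.
  by apply/set0Pn; rewrite -card_gt0; apply: leq_trans le_arcs; rewrite muln_gt0.
have {}xy : adj x y by rewrite inE in xy.
have [w cov tot] := wt p (f x) (f y) gp (fj _ _ xy).
have [N bN] := below_large p.
(* The isolated vertices of H may be mapped outside the vertices played. *)
pose M := N + \max_x (f x).+1.
have fM z : f z < M.
  by apply: (leq_trans (leq_bigmax (F := fun x => (f x).+1) z)); rewrite /M leq_addl.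
have := arcs_weight finj fM (fun x y xy => cov _ _ (fj x y xy)).
have := tot M (bN M (leq_addr _ _)).
have := arcs_blue finj fj; have := size_ncol p.
set S := \sum_(v < M) w v => sz ab tt aw; exists (ncol red p); first lia.
have : a * (2 * n_edges H) <= a * (max_degree H * S).
  by rewrite leq_mul2l (leq_trans le_arcs aw) orbT.
have : max_degree H * (a * S + b) <= max_degree H * (c * ncol red p).
  by rewrite leq_mul2l tt orbT.
nia.
Qed.

(** * Excluding red paths *)

(** Interior vertices of a path have two red neighbours, hence are inner;
    consecutive ones share their label, so the k - 1 interior vertices of a path
    with k edges would form a class that is too large. *)
Lemma no_red_path k p (inner : pred nat) (lab : nat -> nat) : 1 < k ->
  (forall x y z, ~~ inner x -> joined p red x y -> joined p red x z -> y = z) ->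
  (forall x y, inner x -> inner y -> joined p red x y -> lab x = lab y) ->
  (forall s i, uniq s -> {in s, forall x, inner x && (lab x == i)} ->
     (size s).+1 < k) ->
  ~ has_copy (path_graph k.+1) red p.
Proof.
move=> k1 deg edg small [f finj fj].
pose g i := f (inord i : 'I_k.+1).
have ginj i j : i <= k -> j <= k -> g i = g j -> i = j.
  by move=> ik jk /finj /(congr1 val); rewrite /= !inordK.
have gj i : i < k -> joined p red (g i) (g i.+1).
  by move=> ik; apply: fj; rewrite /= /path_adj /= !inordK ?eqxx // ltnW.
have inn i : 0 < i < k -> inner (g i).
  case: i => // i /= ik; apply/negPn/negP => ni.
  have := gj i (ltnW ik); rewrite joined_sym => j1.
  have := deg _ _ _ ni j1 (gj _ ik).
  by move/(ginj _ _ (ltnW (ltnW ik)) ik); lia.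
have lab1 i : 0 < i < k -> lab (g i) = lab (g 1).
  case: i => // i; elim: i => // i IHi ik.
  by rewrite -(edg (g i.+1)) ?gj ?inn //; [apply: IHi; lia | lia..].
have := small [seq g i | i <- iota 1 k.-1] (lab (g 1)).
rewrite size_map size_iota prednK ?ltnn; last lia.
move=> sm; suff: false by []; apply: sm.
  rewrite map_inj_in_uniq ?iota_uniq // => i j; rewrite !mem_iota => hi hj.
  by apply: ginj; lia.
move=> _ /mapP[i + ->]; rewrite mem_iota => hi.
by rewrite inn ?lab1 ?eqxx //; lia.
Qed.

(** * Sums changed at few places *)

(** A form without subtraction of the change of a sum when its terms change on
    [s] only. *)
Lemma sum_update N (s : seq nat) (F F' : nat -> nat) :
  uniq s -> (forall x, x \in s -> x < N) ->
  (forall x, x \notin s -> F' x = F x) ->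
  \sum_(x < N) F' x + \sum_(x <- s) F x = \sum_(x < N) F x + \sum_(x <- s) F' x.
Proof.
move=> us sN eqF.
have split (K : nat -> nat) : \sum_(x < N) K x =
    \sum_(x <- s) K x + \sum_(0 <= x < N | x \notin s) K x.
  rewrite -(big_mkord xpredT K) (bigID (mem s)) /=; congr (_ + _).
  rewrite -big_filter; apply: perm_big; apply: uniq_perm => //.
    by rewrite filter_uniq // iota_uniq.
  by move=> x; rewrite mem_filter mem_index_iota; case E: (x \in s); rewrite //= sN.
rewrite !split.
have -> : \sum_(0 <= x < N | x \notin s) F' x = \sum_(0 <= x < N | x \notin s) F x.
  by apply: eq_bigr => x /eqF.
lia.
Qed.

Lemma sum_update1 N u (F F' : nat -> nat) : u < N ->
  (forall x, x != u -> F' x = F x) ->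
  \sum_(x < N) F' x + F u = \sum_(x < N) F x + F' u.
Proof.
move=> uN eqF; have := @sum_update N [:: u] F F'.
rewrite !big_cons !big_nil !addn0; apply=> // x; rewrite inE.
  by move/eqP=> ->.
exact: eqF.
Qed.

Lemma sum_update2 N u v (F F' : nat -> nat) : u != v -> u < N -> v < N ->
  (forall x, x != u -> x != v -> F' x = F x) ->
  \sum_(x < N) F' x + (F u + F v) = \sum_(x < N) F x + (F' u + F' v).
Proof.
move=> uv uN vN eqF; have := @sum_update N [:: u; v] F F'.
rewrite /= inE uv !big_cons !big_nil !addn0; apply=> // x; rewrite !inE.
  by case/orP=> /eqP->.
by rewrite negb_or => /andP[xu xv]; apply: eqF.
Qed.

(** * Red paths with two edges *)

(** Painter answers red exactly when both ends are untouched. *)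
Lemma online_bound2 (H : sgraph) : 0 < n_edges H ->
  exists2 R, n_edges H + R <= online_ramsey (path_graph 3) H &
    2 * n_edges H <= max_degree H * 4 * R.
Proof.
move=> l0.
pose Good p := exists t : pred nat,
  [/\ forall x y z, joined p red x y -> joined p red x z -> y = z,
      forall x y, joined p red x y -> t x,
      forall x y, joined p blue x y -> t x || t y &
      forall N, below N p -> \sum_(x < N) (t x : nat) <= 2 * ncol red p].
have [||||R] := @online_bound (path_graph 3) H 1 0 4 Good l0.
- by exists pred0; split=> // N _; rewrite big1.
- move=> p e [t [deg red_t blue_t tot]].
  have [u [v euv]] := edge_ends e.
  have J := joined_cons _ _ _ _ _ euv.
  have [tuv|] := boolP (t u || t v).
    exists blue, t; split.
    + by move=> x y z; rewrite !J /=; apply: deg.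
    + by move=> x y; rewrite J /=; apply: red_t.
    + move=> x y; rewrite J /= => /orP[/orP[]/andP[/eqP-> /eqP->]|/blue_t] //.
      by rewrite orbC.
    + by move=> N /(below_cons euv)[_ _ bN]; rewrite /ncol /= add0n tot.
  rewrite negb_or => /andP[tu tv]; have uv := ends_neq euv.
  have tN x y z : joined p red x y -> ~~ t z -> x == z = false.
    by move=> /red_t tx; apply: contraNF => /eqP <-.
  exists red, (fun x => [|| t x, x == u | x == v]); split.
  + move=> x y z; rewrite !J /=.
    case/orP=> [/orP[]/andP[/eqP-> /eqP->]|j1].
    * rewrite eqxx (negbTE uv) /= orbF => /orP[/eqP->//|j].
      by have := tN _ _ _ j tu; rewrite eqxx.
    * rewrite eqxx (eq_sym v) (negbTE uv) /= => /orP[/eqP->//|j].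
      by have := tN _ _ _ j tv; rewrite eqxx.
    * by rewrite !(tN _ _ _ j1) //=; apply: deg j1.
  + move=> x y; rewrite J /= => /orP[/orP[]/andP[/eqP-> _]|/red_t ->] //;
      by rewrite eqxx ?orbT.
  + by move=> x y; rewrite J /= => /blue_t /orP[] ->; rewrite ?orbT.
  + move=> N /(below_cons euv)[uN vN bN]; have {tot} := tot N bN.
    have := @sum_update2 N u v (fun x => t x : nat)
              (fun x => [|| t x, x == u | x == v] : nat) uv uN vN.
    rewrite /ncol /= !eqxx !orbT (negbTE tu) (negbTE tv) -/(ncol red p) => su tot.
    have {su} := su _; rewrite [_ + (false + false)]addn0 => -> //.
      by move: tot; rewrite mulnDr; lia.
    by move=> x /negbTE -> /negbTE ->; rewrite !orbF.
- move=> p [t [deg _ _ _]]; apply: (@no_red_path 2 p pred0 id) => //.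
  + by move=> x y z _; apply: deg.
  + by move=> [|x s] i // _ /(_ x (mem_head _ _)).
- move=> p x y [t [_ _ blue_t tot]] _; exists (fun x => 2 * t x).
    by move=> x' y' /blue_t; case: (t x'); case: (t y').
  by move=> N /tot; rewrite -big_distrr /=; lia.
move=> le1 le2; exists R => //; lia.
Qed.

(** * Red paths with three edges *)

(** [Paired]: end of a single red edge; [Centre] and [Leaf]: in a star with at least
    two edges. *)
Inductive role := Fresh | Paired | Centre | Leaf.

Definition is_centre r := if r is Centre then true else false.

Definition red_roles r1 r2 := match r1, r2 with
  | Paired, Paired | Centre, Leaf | Leaf, Centre => true
  | _, _ => false end.

Definition role_weight r :=
  match r with Fresh => 0 | Paired => 1 | Centre => 1 | Leaf => 2 end.

(** Four times the weight, plus 1 on paired vertices.  The extra unit makes a single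
    edge cost 10, and pays for turning it into a star with two edges
    (8 + 4 + 8 = 20); each further leaf costs only 8.  So a red edge never adds more
    than 10. *)
Definition role_cost r :=
  match r with Fresh => 0 | Paired => 5 | Centre => 4 | Leaf => 8 end.

Record role_state (p : position) (ro : nat -> role) : Prop := RoleState {
  role_deg : forall x y z,
    ~~ is_centre (ro x) -> joined p red x y -> joined p red x z -> y = z;
  role_red : forall x y, joined p red x y -> red_roles (ro x) (ro y);
  role_mate : forall x, ro x = Paired -> exists y, joined p red x y;
  role_blue : forall x y,
    joined p blue x y -> 2 <= role_weight (ro x) + role_weight (ro y);
  role_count : forall N, below N p ->
    \sum_(x < N) role_cost (ro x) <= 10 * ncol red p }.

Lemma role_state_blue p ro e u v : ends e u v -> role_state p ro ->
  2 <= role_weight (ro u) + role_weight (ro v) ->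
  role_state ((e, blue) :: p) ro.
Proof.
move=> euv st wuv; have J := joined_cons _ _ _ _ _ euv; split.
- by move=> x y z; rewrite !J /=; apply: role_deg st _ _ _.
- by move=> x y; rewrite !J /=; apply: role_red st _ _.
- by move=> x /(role_mate st)[y xy]; exists y; rewrite J.
- move=> x y; rewrite J /= => /orP[/orP[]/andP[/eqP-> /eqP->]|/(role_blue st)] //.
  by rewrite addnC.
- by move=> N /(below_cons euv)[_ _ bN]; rewrite /ncol /= add0n; apply: role_count st _ _.
Qed.

(** The answer is blue as soon as the ends weigh 2 together.  Otherwise one end is
    fresh and the other is fresh, paired or a centre. *)
Lemma role_state_red p ro e u v : ends e u v -> role_state p ro ->
  ro u = Fresh -> role_weight (ro v) <= 1 ->
  exists ro', role_state ((e, red) :: p) ro'.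
Proof.
move=> euv st ru wv; have J := joined_cons _ _ _ _ _ euv; have uv := ends_neq euv.
have vu : v != u by rewrite eq_sym.
have nou x y : joined p red x y -> (x == u = false) * (y == u = false).
  move=> /(role_red st) h; split; apply/eqP => E; move: h; rewrite E ru //.
  by case: (ro x).
case rv: (ro v) wv => // _.
- have nov x y : joined p red x y -> (x == v = false) * (y == v = false).
    move=> /(role_red st) h; split; apply/eqP => E; move: h; rewrite E rv //.
    by case: (ro x).
  exists (fun x => if (x == u) || (x == v) then Paired else ro x); split.
  + move=> x y z; rewrite !J /= => nc /orP[/orP[]/andP[/eqP E /eqP->]|j].
    * rewrite E eqxx (negbTE uv) /= orbF => /orP[/eqP->//|j].
      by have := nou _ _ j; rewrite eqxx => -[].
    * rewrite E eqxx (negbTE vu) /= => /orP[/eqP->//|j].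
      by have := nov _ _ j; rewrite eqxx => -[].
    * rewrite (nou _ _ j) (nov _ _ j) /= in nc *; exact: role_deg st _ _ _ nc j.
  + move=> x y; rewrite J /= => /orP[/orP[]/andP[/eqP-> /eqP->]|j].
    * by rewrite !eqxx ?orbT.
    * by rewrite !eqxx ?orbT.
    * by rewrite !(nou _ _ j) !(nov _ _ j); apply: role_red st _ _ j.
  + move=> x; have [->|_] := eqVneq x u.
      by exists v; rewrite J !eqxx.
    have [->|_] := eqVneq x v; first by exists u; rewrite J !eqxx orbT.
    by move=> /(role_mate st)[y j]; exists y; rewrite J j orbT.
  + move=> x y; rewrite J /= => /(role_blue st) h; apply: leq_trans h _.
    have mono z : role_weight (ro z) <=
        role_weight (if (z == u) || (z == v) then Paired else ro z).
      by have [->|_] := eqVneq z u; [rewrite ru|have [->|] := eqVneq z v; rewrite ?rv].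
    exact: leq_add.
  + move=> N /(below_cons euv)[uN vN /(role_count st)].
    have := @sum_update2 N u v (fun x => role_cost (ro x))
      (fun x => role_cost (if (x == u) || (x == v) then Paired else ro x)) uv uN vN.
    rewrite ru rv !eqxx orbT /= /ncol /= => su.
    have {su} := su _; rewrite [_ + (0 + 0)]addn0 => -> //; first by rewrite mulnDr; lia.
    by move=> x /negbTE -> /negbTE ->.
(* The single edge from v to u' becomes a star centred at v. *)
- have [u' vu'] := role_mate st rv; have u'v : u' != v.
    by rewrite eq_sym; apply: joined_neq vu'.
  have [_ u'u] := nou _ _ vu'.
  have ru' : ro u' = Paired.
    by have := role_red st vu'; rewrite rv; case: (ro u').
  have vnbr y : joined p red v y -> y = u'.
    by move=> j; apply: role_deg st _ _ _ _ j vu'; rewrite rv.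
  have u'nbr y : joined p red u' y -> y = v.
    by move=> j; apply: role_deg st _ _ _ _ j _; rewrite ?ru' // joined_sym.
  exists (fun x => if x == v then Centre else if (x == u) || (x == u') then Leaf
                   else ro x); split.
  + move=> x y z; rewrite !J /=; case: (eqVneq x v) => [//|xv].
    have [->|xu] := eqVneq x u.
      move=> _; rewrite !orbF => /orP[/eqP->|/nou[]]; last by rewrite eqxx.
      by case/orP=> [/eqP->|/nou[]]; last by rewrite eqxx.
    have [->|xu'] /= := eqVneq x u'; first by move=> _ /u'nbr -> /u'nbr ->.
    by apply: role_deg st _ _ _.
  + move=> x y; rewrite J /= => /orP[/orP[]/andP[/eqP-> /eqP->]|j].
    * by rewrite !eqxx (negbTE uv).
    * by rewrite !eqxx (negbTE uv).
    * rewrite !(nou _ _ j) /=.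
      have [xv|xv] := eqVneq x v.
        by rewrite xv in j; rewrite (vnbr _ j) (negbTE u'v) eqxx.
      have [xu'|xu'] := eqVneq x u'.
        by rewrite xu' in j; rewrite (u'nbr _ j) eqxx.
      have [yv|yv] := eqVneq y v.
        by move: j xu'; rewrite yv joined_sym => /vnbr ->; rewrite eqxx.
      have [yu'|yu'] := eqVneq y u'.
        by move: j xv; rewrite yu' joined_sym => /u'nbr ->; rewrite eqxx.
      exact: role_red st _ _ j.
  + move=> x; do 2 case: ifP => // _.
    by move=> /(role_mate st)[y j]; exists y; rewrite J j orbT.
  + move=> x y; rewrite J /= => /(role_blue st) h; apply: leq_trans h _.
    have mono z : role_weight (ro z) <= role_weight
        (if z == v then Centre else if (z == u) || (z == u') then Leaf else ro z).
      have [->|_] := eqVneq z v; first by rewrite rv.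
      by case: ifP => // _; case: (ro z).
    exact: leq_add.
  + move=> N b; have [uN vN bN] := below_cons euv b; have := role_count st bN.
    have u'N : u' < N by apply: (bN red u' v); rewrite joined_sym.
    have -> : ncol red ((e, red) :: p) = (ncol red p).+1 by [].
    rewrite mulnS; have us : uniq [:: u; v; u'].
      by rewrite /= !inE negb_or uv (eq_sym u) u'u (eq_sym v) u'v.
    have sN x : x \in [:: u; v; u'] -> x < N.
      by rewrite !inE => /or3P[]/eqP->.
    have := @sum_update N [:: u; v; u'] (fun x => role_cost (ro x))
      (fun x => role_cost (if x == v then Centre else
                           if (x == u) || (x == u') then Leaf else ro x)) us sN.
    rewrite !big_cons !big_nil ru rv ru' !eqxx (negbTE uv) (negbTE u'v) orbT /=.
    move=> su tot.
    have su' : forall x, x \notin [:: u; v; u'] -> 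
      role_cost (if x == v then Centre else
                 if (x == u) || (x == u') then Leaf else ro x) = role_cost (ro x).
      by move=> x; rewrite !inE !negb_or => /and3P[/negbTE-> /negbTE-> /negbTE->].
    by have {su su'} := su su'; lia.
- exists (fun x => if x == u then Leaf else ro x); split.
  + move=> x y z; rewrite !J /=; have [->|xu] := eqVneq x u.
      move=> _; rewrite (negbTE uv) /= !orbF.
      move=> /orP[/eqP->|/nou[]]; last by rewrite eqxx.
      by case/orP=> [/eqP->|/nou[]]; last by rewrite eqxx.
    have [->|xv] /= := eqVneq x v; first by rewrite rv.
    by apply: role_deg st _ _ _.
  + move=> x y; rewrite J /= => /orP[/orP[]/andP[/eqP-> /eqP->]|j].
    * by rewrite eqxx (negbTE vu) rv.
    * by rewrite eqxx (negbTE vu) rv.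
    * by rewrite !(nou _ _ j); apply: role_red st _ _ j.
  + move=> x; case: ifP => // _.
    by move=> /(role_mate st)[y j]; exists y; rewrite J j orbT.
  + move=> x y; rewrite J /= => /(role_blue st) h; apply: leq_trans h _.
    have mono z : role_weight (ro z) <= role_weight (if z == u then Leaf else ro z).
      by case: ifP => // _; case: (ro z).
    exact: leq_add.
  + move=> N b; have [uN vN bN] := below_cons euv b; have := role_count st bN.
    have := @sum_update2 N u v (fun x => role_cost (ro x))
      (fun x => role_cost (if x == u then Leaf else ro x)) uv uN vN.
    rewrite ru (negbTE vu) rv eqxx /ncol /= => su.
    have {su} := su _; rewrite mulnDr -/(ncol red p) => su tot.
    by rewrite -(leq_add2r (0 + 4)) su; [lia | move=> x /negbTE ->].
Qed.

Lemma online_bound3 (H : sgraph) : 0 < n_edges H ->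
  exists2 R, n_edges H + R <= online_ramsey (path_graph 4) H &
    8 * n_edges H <= max_degree H * 10 * R.
Proof.
move=> l0.
have [||||R le1 le2] := @online_bound (path_graph 4) H 4 0 10
  (fun p => exists ro, role_state p ro) l0.
- by exists (fun=> Fresh); split=> // N _; rewrite big1.
- move=> p e [ro st]; have [u [v euv]] := edge_ends e.
  have [wuv|wuv] := leqP 2 (role_weight (ro u) + role_weight (ro v)).
    by exists blue, ro; apply: role_state_blue euv st wuv.
  have evu : ends e v u by rewrite ends_sym.
  exists red; case ru: (ro u) wuv; case rv: (ro v) => // _;
    first [by apply: (role_state_red euv st ru); rewrite rv
          |by apply: (role_state_red evu st rv); rewrite ru].
- move=> p [ro st]; apply: (@no_red_path 3 p (is_centre \o ro) id) => //.
  + exact: role_deg st.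
  + by move=> x y /= cx cy /(role_red st); case: (ro x) cx => //; case: (ro y) cy.
  + move=> [|x [|y s]] i //= /andP[]; rewrite inE negb_or => /andP[xy _ _] h.
    case/negP: xy; have /andP[_ /eqP ->] := h x (mem_head _ _).
    by have := h y; rewrite !inE eqxx orbT => /(_ isT) /andP[_ /eqP ->].
- move=> p x y [ro st] _; exists (role_weight \o ro); first exact: role_blue st.
  move=> N /(role_count st) tot; rewrite addn0; apply: leq_trans tot.
  by rewrite big_distrr /=; apply: leq_sum => z _; case: (ro z).
by exists R => //; lia.
Qed.

(** * Longer red paths *)

(** [lab x] is the label of the core of [x], and [sz i] bounds the number of
    vertices of the core labelled [i].  An untouched vertex is a core of size 1, of
    weight 0. *)
Definition core_weight (lab sz : nat -> nat) (leaf : pred nat) (x : nat) : nat :=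
  if leaf x then 2 else 1 < sz (lab x).

Definition pendant (p : position) (x : nat) : Prop :=
  forall y z, joined p red x y -> joined p red x z -> y = z.

(** [exc i] counts red edges in the core [i] beyond a spanning tree.  A core with
    [exc i = 0] is a tree, and the only trace of this that is kept is [core_ends]:
    it has two end vertices, so one of them survives when an edge is attached
    anywhere.  Full cores are exempt, as leaves may hang on all their vertices.
    The bound k - 2 on [sz] is kept apart, because merging may produce a core with
    k - 1 vertices, of which an end vertex is then demoted. *)
Record core_state (k : nat) (p : position) (lab sz exc : nat -> nat)
    (leaf : pred nat) : Prop := CoreState {
  leaf_pendant : forall x, leaf x -> pendant p x;
  core_red : forall x y,
    ~~ leaf x -> ~~ leaf y -> joined p red x y -> lab x = lab y;
  red_size : forall x y, ~~ leaf x -> joined p red x y -> 1 < sz (lab x);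
  core_card : forall s i, uniq s ->
    {in s, forall x, ~~ leaf x && (lab x == i)} -> size s <= sz i;
  core_ends : forall i, 1 < sz i < k - 2 -> exc i = 0 ->
    exists d1 d2, [/\ d1 != d2, ~~ leaf d1 /\ ~~ leaf d2,
      lab d1 = i /\ lab d2 = i & pendant p d1 /\ pendant p d2];
  core_blue : forall x y, joined p blue x y ->
    2 <= core_weight lab sz leaf x + core_weight lab sz leaf y;
  lab_below : forall N, below N p -> forall x, x < N -> lab x < N;
  red_count : forall N, below N p ->
    \sum_(x < N) (leaf x : nat) + \sum_(i < N) ((sz i).-1 + exc i) <= ncol red p;
  slack : (exists x, leaf x) \/ (exists x y, joined p blue x y) ->
    forall N, below N p -> k - 4 <= \sum_(i < N) (sz i - 2 + 2 * exc i) }.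

Definition relabel (lab : nat -> nat) (i j x : nat) : nat :=
  if lab x == j then i else lab x.

(** Used for sizes and for excesses: both add up when two cores are joined by a
    single edge. *)
Definition absorb (f : nat -> nat) (i j x : nat) : nat :=
  if x == i then f i + f j else if x == j then 0 else f x.

Section CoreMoves.

Variables (k : nat) (p : position) (lab sz exc : nat -> nat) (leaf : pred nat).
Variables (e : edge) (u v : nat).
Hypotheses (st : core_state k p lab sz exc leaf) (euv : ends e u v).

Let J c c' x y : joined ((e, c) :: p) c' x y =
  (c == c') && ((x == u) && (y == v) || (x == v) && (y == u)) || joined p c' x y.
Proof. exact: joined_cons. Qed.

Let uv : u != v := ends_neq euv.
Let vu : v != u. Proof. by rewrite eq_sym. Qed.

Let pendant_cons x : x != u -> x != v -> pendant p x -> pendant ((e, red) :: p) x.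
Proof.
by move=> xu xv px y z; rewrite !J (negbTE xu) (negbTE xv) /=; apply: px.
Qed.

Lemma core_size_gt0 x : ~~ leaf x -> 0 < sz (lab x).
Proof.
move=> lx; apply: (core_card st (s := [:: x])) => // y.
by rewrite inE => /eqP->; rewrite lx /=.
Qed.

Lemma core_state_blue :
  2 <= core_weight lab sz leaf u + core_weight lab sz leaf v ->
  (forall N, u < N -> v < N -> below N p ->
     k - 4 <= \sum_(i < N) (sz i - 2 + 2 * exc i)) ->
  core_state k ((e, blue) :: p) lab sz exc leaf.
Proof.
move=> wuv sl.
have pend x : pendant p x -> pendant ((e, blue) :: p) x.
  by move=> px y z; rewrite !J /=; apply: px.
split.
- by move=> x /(leaf_pendant st) /pend.
- by move=> x y; rewrite !J /=; apply: core_red st _ _.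
- by move=> x y; rewrite !J /=; apply: red_size st _ _.
- exact: core_card st.
- move=> i si xi; have [d1 [d2 [? ? ? [/pend ? /pend ?]]]] := core_ends st si xi.
  by exists d1, d2; split.
- move=> x y; rewrite J /= => /orP[/orP[]/andP[/eqP-> /eqP->]|/(core_blue st)] //.
  by rewrite addnC.
- by move=> N /(below_cons euv)[_ _ bN]; apply: lab_below st _ bN.
- by move=> N /(below_cons euv)[_ _ bN]; rewrite /ncol /= add0n; apply: red_count st _ bN.
- by move=> _ N /(below_cons euv)[uN vN bN]; apply: sl.
Qed.

(** An edge inside a core cannot lengthen paths beyond the bound, and adds 1 to the
    excess. *)
Lemma core_state_inside : ~~ leaf u -> ~~ leaf v -> lab u = lab v ->
  core_state k ((e, red) :: p) lab sz (fun i => (i == lab u) + exc i) leaf.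
Proof.
move=> lu lv luv; split.
- move=> x lx; apply: pendant_cons (leaf_pendant st lx).
    by apply: contraTneq lx => ->.
  by apply: contraTneq lx => ->.
- move=> x y lx ly; rewrite !J /= => /orP[/orP[]/andP[/eqP-> /eqP->]|] //.
  exact: core_red st _ _ lx ly.
- have s2 : 1 < sz (lab u).
    apply: (core_card st (s := [:: u; v])); first by rewrite /= inE uv.
    by move=> y; rewrite !inE => /orP[]/eqP->; rewrite ?lu ?lv ?luv eqxx.
  move=> x y lx; rewrite !J /= => /orP[/orP[]/andP[/eqP-> _]|] //.
    by rewrite -luv.
  exact: red_size st _ _ lx.
- exact: core_card st.
- move=> i si; case: eqVneq => // iu xi.
  have [d1 [d2 [d12 l12 [e1 e2] [p1 p2]]]] := core_ends st si xi.
  have off d : lab d = i -> d != u /\ d != v.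
    by move=> di; split; apply: contraNneq iu => E; rewrite -di E ?luv.
  have [d1u d1v] := off d1 e1; have [d2u d2v] := off d2 e2.
  by exists d1, d2; split=> //; split; apply: pendant_cons.
- by move=> x y; rewrite J /=; apply: core_blue st _ _.
- by move=> N /(below_cons euv)[_ _ bN]; apply: lab_below st _ bN.
- move=> N /(below_cons euv)[uN vN bN]; rewrite ncol_red.
  have uN' := lab_below st bN uN; have := red_count st bN.
  have := @sum_update1 N (lab u) (fun i => (sz i).-1 + exc i)
    (fun i => (sz i).-1 + ((i == lab u) + exc i)) uN'.
  rewrite eqxx => su tot; have {su} := su (fun x xl =>
    congr1 (fun b : bool => (sz x).-1 + (b + exc x)) (negbTE xl)).
  lia.
- move=> h N /(below_cons euv)[_ _ bN].
  apply: (@leq_trans (\sum_(i < N) (sz i - 2 + 2 * exc i))).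
    apply: (slack st _ bN).
    by case: h => [|[x [y]]]; [left | rewrite J /=; right; exists x, y].
  by apply: leq_sum => i _; rewrite leq_add2l leq_mul2l leq_addl orbT.
Qed.

(** A tree with two end vertices keeps one that is not the attachment point; an
    untouched vertex becomes an end vertex itself. *)
Lemma merge_end : ~~ leaf u -> lab u != lab v ->
  sz (lab u) < k - 2 -> exc (lab u) = 0 ->
  exists d, [/\ ~~ leaf d, lab d = lab u & pendant ((e, red) :: p) d].
Proof.
move=> lu luv lt xu.
have [su|su] := ltnP 1 (sz (lab u)); last first.
  exists u; split=> // y z; rewrite !J !eqxx (negbTE uv) /= !orbF.
  have nou w : joined p red u w = false.
    by apply/negP => /(red_size st lu); lia.
  by rewrite !nou !orbF => /eqP -> /eqP ->.
have su' : 1 < sz (lab u) < k - 2 by rewrite su lt.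
have [d1 [d2 [d12 [l1 l2] [e1 e2] [p1 p2]]]] := core_ends st su' xu.
have offv d : lab d = lab u -> d != v by move=> du; apply: contraNneq luv => <-; rewrite du.
have [d1u|d1u] := eqVneq d1 u.
  by exists d2; split=> //; apply: pendant_cons; rewrite ?offv // -d1u eq_sym.
by exists d1; split=> //; apply: pendant_cons; rewrite ?offv.
Qed.

Lemma core_state_merge : ~~ leaf u -> ~~ leaf v -> lab u != lab v ->
  (exc (lab u) + exc (lab v) = 0 -> sz (lab u) + sz (lab v) < k - 2 ->
   exists d1 d2, [/\ ~~ leaf d1 /\ ~~ leaf d2, lab d1 = lab u /\ lab d2 = lab v &
     pendant ((e, red) :: p) d1 /\ pendant ((e, red) :: p) d2]) ->
  core_state k ((e, red) :: p) (relabel lab (lab u) (lab v))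
    (absorb sz (lab u) (lab v)) (absorb exc (lab u) (lab v)) leaf.
Proof.
move=> lu lv luv; have := core_size_gt0 lu; have := core_size_gt0 lv.
set i := lab u in luv *; set j := lab v in luv * => j0 i0 two_ends.
have ji : j == i = false by rewrite eq_sym (negbTE luv).
set lab' := relabel lab i j.
have absi f : absorb f i j i = f i + f j by rewrite /absorb eqxx.
have absj f : absorb f i j j = 0 by rewrite /absorb ji eqxx.
have absx f x : x != i -> x != j -> absorb f i j x = f x.
  by rewrite /absorb => /negbTE-> /negbTE->.
have grow x : sz (lab x) <= absorb sz i j (lab' x).
  rewrite /lab' /relabel; have [->|xj] := eqVneq (lab x) j; first by rewrite absi leq_addl.
  by have [->|xi] := eqVneq (lab x) i; [rewrite absi leq_addr | rewrite absx].
have lab'u : lab' u = i by rewrite /lab' /relabel -/i (negbTE luv).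
have lab'v : lab' v = i by rewrite /lab' /relabel -/j eqxx.
split.
- move=> x lx; apply: pendant_cons (leaf_pendant st lx).
    by apply: contraTneq lx => ->.
  by apply: contraTneq lx => ->.
- move=> x y lx ly; rewrite !J /= => /orP[/orP[]/andP[/eqP-> /eqP->]|].
  + by rewrite lab'u lab'v.
  + by rewrite lab'u lab'v.
  + by move=> /(core_red st lx ly) E; rewrite /lab' /relabel E.
- move=> x y lx; rewrite !J /= => /orP[/orP[]/andP[/eqP-> _]|j1].
  + by rewrite lab'u absi; lia.
  + by rewrite lab'v absi; lia.
  + by apply: leq_trans (grow x); apply: red_size st _ _ lx j1.
- move=> s i1 us hs; have [i1i|i1i] := eqVneq i1 i.
    rewrite {}i1i in hs *; rewrite absi -(count_predC (fun x => lab x == i) s).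
    rewrite -!size_filter.
    apply: leq_add; apply: (core_card st); rewrite ?filter_uniq // => x;
      rewrite mem_filter /= => /andP[xi /hs /andP[-> /=]] //.
    by rewrite /lab' /relabel; case: (eqVneq (lab x) j) => // _; rewrite (negbTE xi).
  have hs' : {in s, forall x, ~~ leaf x && (lab x == i1)}.
    move=> x /hs /andP[-> /=]; rewrite /lab' /relabel.
    by case: (eqVneq (lab x) j) => // _ /eqP E; rewrite -E eqxx in i1i.
  have [E|i1j] := eqVneq i1 j; last by rewrite absx // (core_card st us hs').
  case: s us hs hs' => // x s _ hs hs'.
  have /andP[_ /eqP] := hs x (mem_head _ _); have /andP[_ /eqP] := hs' x (mem_head _ _).
  by rewrite /lab' /relabel E => -> /eqP; rewrite eqxx (negbTE luv).
- move=> i1; have [->|i1i] := eqVneq i1 i.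
    rewrite !absi => /andP[_ lt] /two_ends /(_ lt).
    move=> [d1 [d2 [l12 [e1 e2] p12]]]; exists d1, d2; split=> //.
      by apply: contraNneq luv => E; rewrite -e1 -e2 E.
    by rewrite /lab' /relabel e1 e2 eqxx (negbTE luv).
  have [->|i1j] := eqVneq i1 j; first by rewrite absj.
  rewrite !absx // => si xi.
  have [d1 [d2 [d12 l12 [e1 e2] [p1 p2]]]] := core_ends st si xi.
  exists d1, d2; split=> //; first by rewrite /lab' /relabel e1 e2 (negbTE i1j).
  have off d : lab d = i1 -> d != u /\ d != v.
    move=> di; split; first by apply: contraNneq i1i => E; rewrite -di E.
    by apply: contraNneq i1j => E; rewrite -di E.
  have [d1u d1v] := off d1 e1; have [d2u d2v] := off d2 e2.
  by split; apply: pendant_cons.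
- move=> x y; rewrite J /= => /(core_blue st) h; apply: leq_trans h _.
  have mono z : core_weight lab sz leaf z <= core_weight lab' (absorb sz i j) leaf z.
    rewrite /core_weight; case: (leaf z) => //; have := grow z; lia.
  exact: leq_add.
- move=> N /(below_cons euv)[uN vN bN] x xN; rewrite /lab' /relabel.
  by case: ifP => _; apply: lab_below st _ bN _ _.
- move=> N /(below_cons euv)[uN vN bN].
  have iN : i < N by apply: lab_below st _ bN _ uN.
  have jN : j < N by apply: lab_below st _ bN _ vN.
  have := red_count st bN; rewrite ncol_red.
  have := @sum_update2 N i j (fun x => (sz x).-1 + exc x)
    (fun x => (absorb sz i j x).-1 + absorb exc i j x) luv iN jN.
  rewrite !absi !absj => su.
  have {}su := su (fun x xi xj => f_equal2 (fun a b => a.-1 + b)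
    (absx sz x xi xj) (absx exc x xi xj)).
  lia.
- move=> h N /(below_cons euv)[uN vN bN].
  have iN : i < N by apply: lab_below st _ bN _ uN.
  have jN : j < N by apply: lab_below st _ bN _ vN.
  have : k - 4 <= \sum_(i < N) (sz i - 2 + 2 * exc i).
    apply: (slack st _ bN).
    by case: h => [|[x [y]]]; [left | rewrite J /=; right; exists x, y].
  have := @sum_update2 N i j (fun x => sz x - 2 + 2 * exc x)
    (fun x => absorb sz i j x - 2 + 2 * absorb exc i j x) luv iN jN.
  rewrite !absi !absj => su.
  have {}su := su (fun x xi xj => f_equal2 (fun a b => a - 2 + 2 * b)
    (absx sz x xi xj) (absx exc x xi xj)).
  lia.
Qed.

(** An untouched vertex becomes a leaf on a full core.  The full core provides the
    slack. *)
Lemma core_state_hang : 3 < k -> ~~ leaf u -> ~~ leaf v ->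
  sz (lab u) = 1 -> sz (lab v) = k - 2 -> lab u != lab v ->
  core_state k ((e, red) :: p) lab sz exc (fun x => (x == u) || leaf x).
Proof.
move=> k4 lu lv su sv luv.
have nou x : joined p red u x = false.
  by apply/negP => /(red_size st lu); rewrite su.
have nou' x : joined p red x u = false by rewrite joined_sym.
split.
- move=> x; have [-> _ y z|xu /= lx] := eqVneq x u.
    by rewrite !J !nou !eqxx (negbTE uv) /= !orbF => /eqP -> /eqP ->.
  apply: pendant_cons (leaf_pendant st lx) => //.
  by apply: contraTneq lx => ->.
- move=> x y; rewrite !negb_or => /andP[xu lx] /andP[yu ly].
  by rewrite !J /= (negbTE xu) (negbTE yu) andbF /=; apply: core_red st _ _ lx ly.
- move=> x y; rewrite negb_or => /andP[xu lx].
  rewrite !J /= (negbTE xu) /= => /orP[/andP[/eqP-> _]|]; first by rewrite sv; lia.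
  exact: red_size st _ _ lx.
- move=> s i us hs; apply: (core_card st us) => x /hs.
  by rewrite negb_or -andbA => /andP[].
- move=> i si xi.
  have [d1 [d2 [d12 [l1 l2] [e1 e2] [p1 p2]]]] := core_ends st si xi.
  have off d : lab d = i -> d != u /\ d != v.
    by move=> di; split; apply: contraTneq si => E; rewrite -di E ?su ?sv; lia.
  have [d1u d1v] := off d1 e1; have [d2u d2v] := off d2 e2.
  exists d1, d2; split=> //; first by rewrite !negb_or d1u d2u l1 l2.
  by split; apply: pendant_cons.
- move=> x y; rewrite J /= => /(core_blue st) h; apply: leq_trans h _.
  have mono z : core_weight lab sz leaf z <=
      core_weight lab sz (fun x => (x == u) || leaf x) z.
    by rewrite /core_weight; case: (z == u); case: (leaf z); case: (1 < sz _).
  exact: leq_add.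
- by move=> N /(below_cons euv)[_ _ bN]; apply: lab_below st _ bN.
- move=> N /(below_cons euv)[uN vN bN].
  have := red_count st bN; rewrite ncol_red.
  have lfs := @sum_update2 N u v (fun x => leaf x : nat)
    (fun x => (x == u) || leaf x : nat) uv uN vN.
  rewrite eqxx (negbTE lu) (negbTE lv) (negbTE vu) in lfs.
  have {lfs} := lfs (fun x xu _ => congr1 (fun b => b || leaf x : nat) (negbTE xu)).
  lia.
- move=> _ N /(below_cons euv)[uN vN bN].
  have vlN : lab v < N by apply: lab_below st _ bN _ vN.
  rewrite (bigD1 (Ordinal vlN)) //= sv; lia.
Qed.

End CoreMoves.

(** An end vertex of an oversized core is turned into a leaf: the core loses an edge
    of its spanning tree and the set of leaves gains one. *)
Lemma core_state_demote k p lab sz exc leaf d : 3 < k ->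
  core_state k p lab sz exc leaf -> ~~ leaf d -> pendant p d -> sz (lab d) = k - 1 ->
  (forall N, below N p -> lab d < N) ->
  core_state k p lab (fun i => if i == lab d then k - 2 else sz i) exc
    (fun x => (x == d) || leaf x).
Proof.
move=> k4 st ld pd sd below_d; split.
- by move=> x /orP[/eqP->|/(leaf_pendant st)].
- move=> x y; rewrite !negb_or => /andP[_ lx] /andP[_ ly].
  exact: core_red st _ _ lx ly.
- move=> x y; rewrite negb_or => /andP[_ lx] /(red_size st lx).
  by case: ifP => // _ _; lia.
- move=> s i us hs; case: eqVneq => [E|_]; last first.
    by apply: (core_card st us) => x /hs; rewrite negb_or -andbA => /andP[].
  have ds : d \notin s by apply/negP => /hs; rewrite eqxx.
  have := core_card st (s := d :: s) (i := i); rewrite /= ds us => /(_ isT).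
  have -> : sz i = k - 1 by rewrite E.
  move=> le.
  have -> : k - 2 = (k - 1).-1 by lia.
  rewrite -ltnS prednK; last lia.
  apply: le => x; rewrite inE => /orP[/eqP->|/hs]; first by rewrite ld E eqxx.
  by rewrite negb_or -andbA => /andP[].
- move=> i; case: eqVneq => [_|id si xi]; first by lia.
  have [d1 [d2 [d12 [l1 l2] [e1 e2] p12]]] := core_ends st si xi.
  exists d1, d2; split=> //; rewrite !negb_or l1 l2 !andbT.
  by split; apply: contraNneq id => E; rewrite -E ?e1 ?e2.
- move=> x y /(core_blue st) h; apply: leq_trans h _.
  have mono z : core_weight lab sz leaf z <= core_weight lab
      (fun i => if i == lab d then k - 2 else sz i) (fun x => (x == d) || leaf x) z.
    have lt : 1 < k - 2 by lia.
    rewrite /core_weight; case: (z == d); case: (leaf z); case: (lab z == lab d);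
      by rewrite ?lt //; case: (1 < sz _).
  exact: leq_add.
- exact: lab_below st.
- move=> N bN; apply: leq_trans (red_count st bN).
  have lN := below_d N bN.
  have szs := @sum_update1 N (lab d) (fun i => (sz i).-1 + exc i)
    (fun i => (if i == lab d then k - 2 else sz i).-1 + exc i) lN.
  rewrite eqxx sd in szs.
  have {}szs := szs (fun x xd => congr1 (fun b => (if b then k - 2 else sz x).-1 + exc x)
    (negbTE xd)).
  have [dN|Nd] := ltnP d N.
    have lfs := @sum_update1 N d (fun x => leaf x : nat)
      (fun x => (x == d) || leaf x : nat) dN.
    rewrite eqxx (negbTE ld) in lfs.
    have {}lfs := lfs (fun x xd => congr1 (fun b => b || leaf x : nat) (negbTE xd)).
    lia.
  apply: leq_add; last lia.
  by apply: leq_sum => x _; rewrite ltn_eqF // (leq_trans (ltn_ord x)).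
- move=> _ N bN; rewrite (bigD1 (Ordinal (below_d N bN))) //= eqxx; lia.
Qed.

(** The slack that allows a blue edge between two cores. *)
Lemma core_slack_pair k (sz exc : nat -> nat) N i j :
  i < N -> j < N -> i != j -> 1 < sz i -> 1 < sz j ->
  k <= sz i + sz j + exc i + exc j ->
  k - 4 <= \sum_(x < N) (sz x - 2 + 2 * exc x).
Proof.
move=> iN jN ij si sj le.
have ne : Ordinal jN != Ordinal iN by rewrite -val_eqE /= eq_sym.
rewrite (bigD1 (Ordinal iN)) //= (bigD1 (Ordinal jN)) //=; lia.
Qed.

(** A cross edge is red if the merged core fits, or if it attaches an untouched
    vertex to a full core.  Otherwise both cores have at least two vertices, and it
    is blue unless they are trees with k - 1 vertices in all. *)
Lemma core_state_step k p lab sz exc leaf e : 3 < k ->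
  core_state k p lab sz exc leaf -> (forall i, sz i <= k - 2) ->
  exists c lab' sz' exc' leaf',
    core_state k ((e, c) :: p) lab' sz' exc' leaf' /\ forall i, sz' i <= k - 2.
Proof.
move=> k4 st szmax; have [u [v euv]] := edge_ends e.
have evu : ends e v u by rewrite ends_sym.
have [leaf_uv|] := boolP (leaf u || leaf v).
  exists blue, lab, sz, exc, leaf; split=> //; apply: core_state_blue euv _ _ => //.
    by rewrite /core_weight; case/orP: leaf_uv => ->; [apply: leq_addr | apply: leq_addl].
  move=> N uN vN; apply: (slack st); left.
  by case/orP: leaf_uv => l; [exists u | exists v].
rewrite negb_or => /andP[lu lv].
have [luv|luv] := eqVneq (lab u) (lab v).
  exists red, lab, sz, (fun i => (i == lab u) + exc i), leaf; split=> //.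
  exact: core_state_inside st euv lu lv luv.
have lvu : lab v != lab u by rewrite eq_sym.
have u0 := core_size_gt0 st lu; have v0 := core_size_gt0 st lv.
have mu := szmax (lab u); have mv := szmax (lab v).
have [le|gt] := leqP (sz (lab u) + sz (lab v)) (k - 2).
  have ends_uv : exc (lab u) + exc (lab v) = 0 -> exists d1 d2,
      [/\ ~~ leaf d1 /\ ~~ leaf d2, lab d1 = lab u /\ lab d2 = lab v &
       pendant ((e, red) :: p) d1 /\ pendant ((e, red) :: p) d2].
    move=> ex0.
    have [||d1 [? ? ?]] := merge_end st euv lu luv; try lia.
    have [||d2 [? ? ?]] := merge_end st evu lv lvu; try lia.
    by exists d1, d2.
  exists red, (relabel lab (lab u) (lab v)), (absorb sz (lab u) (lab v)),
    (absorb exc (lab u) (lab v)), leaf; split.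
    by apply: core_state_merge => // ex0 _; apply: ends_uv.
  by move=> i; rewrite /absorb; case: ifP => // _; case: ifP.
have [su|su] := eqVneq (sz (lab u)) 1.
  exists red, lab, sz, exc, (fun x => (x == u) || leaf x); split=> //.
  by apply: core_state_hang; rewrite //; lia.
have [sv|sv] := eqVneq (sz (lab v)) 1.
  exists red, lab, sz, exc, (fun x => (x == v) || leaf x); split=> //.
  by apply: core_state_hang; rewrite //; lia.
have su1 : 1 < sz (lab u) by lia.
have sv1 : 1 < sz (lab v) by lia.
have [ge|lt] := leqP k (sz (lab u) + sz (lab v) + exc (lab u) + exc (lab v)).
  exists blue, lab, sz, exc, leaf; split=> //; apply: core_state_blue euv _ _ => //.
    by rewrite /core_weight (negbTE lu) (negbTE lv) su1 sv1.
  move=> N uN vN bN.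
  exact: (core_slack_pair (lab_below st bN uN) (lab_below st bN vN)).
have [||d [ld du pd]] := merge_end st euv lu luv; try lia.
set lab' := relabel lab (lab u) (lab v).
have dlab : lab' d = lab u by rewrite /lab' /relabel du (negbTE luv).
exists red, lab', (fun i => if i == lab' d then k - 2 else absorb sz (lab u) (lab v) i),
  (absorb exc (lab u) (lab v)), (fun x => (x == d) || leaf x); split.
  apply: core_state_demote => //.
  - by apply: core_state_merge => // _; lia.
  - by rewrite dlab /absorb eqxx; lia.
  - move=> N /(below_cons euv)[uN vN bN]; rewrite dlab.
    by apply: lab_below st _ bN _ uN.
move=> i; rewrite dlab /absorb; case: ifP => // iu; rewrite iu; by case: ifP.
Qed.

Lemma core_weight_sum k p lab sz exc leaf N : core_state k p lab sz exc leaf -> below N p ->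
  \sum_(x < N) core_weight lab sz leaf x <=
  2 * (\sum_(x < N) (leaf x : nat)) + \sum_(i < N) (1 < sz i) * sz i.
Proof.
move=> st bN.
pose big x := ~~ leaf x && (1 < sz (lab x)).
have -> : \sum_(x < N) core_weight lab sz leaf x =
    2 * (\sum_(x < N) (leaf x : nat)) + \sum_(x < N) (big x : nat).
  rewrite big_distrr -big_split /=; apply: eq_bigr => x _.
  by rewrite /core_weight /big; case: (leaf x) => //=; lia.
rewrite leq_add2l.
pose olab (x : 'I_N) := Ordinal (lab_below st bN (ltn_ord x)).
rewrite (partition_big olab xpredT) //=; apply: leq_sum => i _.
case si: (1 < sz i); last first.
  rewrite big1 // => x /eqP E; rewrite /big.
  have -> : lab x = i by rewrite -E.
  by rewrite si andbF.
rewrite mul1n; pose s := [seq x <- index_iota 0 N | ~~ leaf x && (lab x == i)].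
have hs : size s <= sz i.
  apply: (core_card st); first by rewrite filter_uniq // iota_uniq.
  by move=> x; rewrite mem_filter => /andP[].
apply: leq_trans hs; rewrite size_filter -sum1_count big_mkord.
rewrite [X in X <= _]big_mkcond [X in _ <= X]big_mkcond /=; apply: leq_sum => x _.
by rewrite -val_eqE /= /big; case: (lab x == i); case: (leaf x); case: (1 < sz _).
Qed.

(** A core of size s >= 2 weighs s, and s + (s - 2) = 2 (s - 1); cores of size at
    most 1 contribute 0 on both sides.  So weight plus slack is at most 2 R. *)
Lemma online_bound4 k (H : sgraph) : 3 < k -> 0 < n_edges H ->
  exists2 R, n_edges H + R <= online_ramsey (path_graph k.+1) H &
    2 * n_edges H + max_degree H * (k - 4) <= max_degree H * 2 * R.
Proof.
move=> k4 l0.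
have [||||R le1 le2] := @online_bound (path_graph k.+1) H 1 (k - 4) 2
  (fun p => exists lab sz exc leaf,
     core_state k p lab sz exc leaf /\ forall i, sz i <= k - 2) l0.
- exists id, (fun=> 1), (fun=> 0), pred0; split=> [|_]; last lia.
  split=> //.
  + move=> s i us hs; apply: (@uniq_leq_size _ s [:: i] us) => x /hs /=.
    by rewrite inE.
  + by move=> N _; rewrite !big1.
  + by case=> [[]|[x [y]]].
- move=> p e [lab [sz [exc [leaf [st szmax]]]]]; exact: core_state_step k4 st szmax.
- move=> p [lab [sz [exc [leaf [st szmax]]]]].
  apply: (@no_red_path k p (predC leaf) lab); first lia.
  + by move=> x y z /=; rewrite negbK => /(leaf_pendant st); apply.
  + exact: core_red st.
  + move=> s i us hs; have := core_card st us hs; have := szmax i; lia.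
- move=> p x y [lab [sz [exc [leaf [st szmax]]]]] xy; exists (core_weight lab sz leaf).
    exact: core_blue st.
  move=> N bN; have := core_weight_sum st bN; have := red_count st bN.
  have : k - 4 <= \sum_(i < N) (sz i - 2 + 2 * exc i).
    by apply: (slack st _ bN); right; exists x, y.
  have : \sum_(i < N) (1 < sz i) * sz i + \sum_(i < N) (sz i - 2 + 2 * exc i) =
         2 * \sum_(i < N) ((sz i).-1 + exc i).
    by rewrite big_distrr -big_split /=; apply: eq_bigr => i _; case: ltnP; lia.
  lia.
by exists R => //; lia.
Qed.

Import Order.TTheory GRing.Theory Num.Theory.
Local Open Scope ring_scope.

Theorem theorem1p4 (k l : nat) (H : sgraph)
    (hk : (2 <= k)%N) (hl : (1 <= l)%N) (Hl : n_edges H = l) :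
  let D : rat := (max_degree H)%:R in
  let r : rat := (online_ramsey (path_graph k.+1) H)%:R in
  r >= (if k == 2%N then (2 * D + 1) * l%:R / (2 * D)
        else if k == 3%N then (5 * D + 4) * l%:R / (5 * D)
        else (D + 1) * l%:R / D)
  /\ (connected H -> (4 <= k)%N ->
      r >= (D + 1) * l%:R / D + Num.min (k%:R / 2 - 2) (#|H|%:R - 1)).
Proof.
subst l => D r; set n : rat := (n_edges H)%:R.
have castD a b c R : (n_edges H + R <= online_ramsey (path_graph k.+1) H)%N ->
    (a * n_edges H + max_degree H * b <= max_degree H * c * R)%N ->
    exists R' : rat, n + R' <= r /\ a%:R * n + D * b%:R <= D * c%:R * R'.
  move=> le1 le2; exists R%:R.
  by rewrite /n /D /r -!natrM -!natrD !ler_nat.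
have D0 : 0 < D.
  rewrite ltr0n lt0n; apply: contraTneq hl => D0; rewrite -leqNgt.
  have := edges_arcs H; suff -> : #|arcs H| = 0%N by case: (n_edges H).
  apply/eqP; rewrite cards_eq0; apply/eqP/setP => -[x y]; rewrite !inE /=.
  apply/negP => xy; have : (degree x <= max_degree H)%N := leq_bigmax x.
  rewrite D0 leqNgt => /negP; apply.
  by apply/card_gt0P; exists y; rewrite inE.
have n0 : 0 <= n by rewrite ler0n.
have long : (3 < k)%N -> (D + 1) * n / D + (k%:R / 2 - 2) <= r.
  move=> k4; have [R le1 le2] := online_bound4 k4 hl.
  have [R' [{}le1 {}le2]] := castD _ _ _ _ le1 le2.
  have -> : (D + 1) * n / D = n + n / D by field; rewrite gt_eqF.
  have : n / D <= R' - (k - 4)%:R / 2.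
    by rewrite ler_pdivrMr //; nra.
  by rewrite natrB //; lra.
split=> [|_ k4]; last first.
  apply: le_trans (long k4); rewrite lerD2l ge_min lexx //.
case: eqP => [E|k2].
  subst k; have [R le1 le2] := online_bound2 hl.
  rewrite -[X in (X <= _)%N]addn0 -(muln0 (max_degree H)) in le2.
  have [R' [{}le1 {}le2]] := castD _ _ _ _ le1 le2.
  by rewrite ler_pdivrMr; nra.
case: eqP => [E|k3].
  subst k; have [R le1 le2] := online_bound3 hl.
  rewrite -[X in (X <= _)%N]addn0 -(muln0 (max_degree H)) in le2.
  have [R' [{}le1 {}le2]] := castD _ _ _ _ le1 le2.
  by rewrite ler_pdivrMr; nra.
have k4 : (3 < k)%N by lia.
apply: le_trans (long k4); rewrite lerDl.
have : (4%:R : rat) <= k%:R by rewrite ler_nat.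
lra.
Qed.
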